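(* Let $\lambda=(\lambda_1,\dots,\lambda_m)$ be a partition of $n$ with $\lambda\neq(1,\dots,1)$. For $\mu=(\mu_1,\dots,\mu_m)\in\mathbb{R}^m$ let $\mathrm{Diag}(\lambda)=\mathrm{Diag}(\lambda)(\mu)$ be a diagonal $n\times n$ matrix with diagonal entries $\mu_1,\dots,\mu_m$, where each $\mu_i$ appears with multiplicity $\lambda_i$ (in a fixed arrangement along the diagonal). Let $I$ be the $n\times n$ identity matrix and let $\mathrm{Skew}(n)$ be the space of real skew-symmetric $n\times n$ matrices. Then the map $$p:\ \mathrm{Skew}(n)\times\mathbb{R}^m\to\mathbb{R}^{n\times n},\qquad (B,\mu)\mapsto (I-B)(I+B)^{-1}\,\mathrm{Diag}(\lambda)\,(I+B)(I-B)^{-1}$$ is a parametrization by rational functions of a Zariski open dense subset of $V_{\mathbb{R}}(\lambda)$; that is, the entries of $p$ are rational functions of the entries of $B$ and of $\mu_1,\dots,\mu_m$, and the image of $p$ is a Zariski open dense subset of $V_{\mathbb{R}}(\lambda)$.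
   Context: A partition $\lambda=(\lambda_1,\dots,\lambda_m)$ of $n$ is a weakly decreasing sequence of positive integers with sum $n$. Identify the space of real symmetric $n\times n$ matrices with $\mathbb{R}^{n(n+1)/2}$ (a linear subspace of $\mathbb{R}^{n\times n}$). The variety of $\lambda$-partitioned eigenvalues $V_{\mathbb{R}}(\lambda)\subset\mathbb{R}^{n(n+1)/2}$ is the Zariski closure of the set of real symmetric $n\times n$ matrices having exactly $m$ distinct eigenvalues, with multiplicities $\lambda_1,\dots,\lambda_m$. *)

(* Defs.v *)
From mathcomp Require Import all_boot all_order all_algebra.
From mathcomp Require Import mpoly.
From mathcomp Require Import boolp classical_sets reals.

Set Implicit Arguments.
Unset Strict Implicit.
Unset Printing Implicit Defensive.

Import GRing.Theory.
Local Open Scope classical_set_scope.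
Local Open Scope ring_scope.

Section Zariski.
Variables (R : realType) (n : nat).
Implicit Types (S U V Z : set 'M[R]_n) (F : set {mpoly R[n * n]}).

(* Value of a polynomial in the n * n matrix entries at A; the variable of
   index [mxvec_index i j] stands for the entry A i j. *)
Definition mx_eval (f : {mpoly R[n * n]}) (A : 'M[R]_n) : R :=
  f.@[fun k => mxvec A 0 k].

Definition zero_locus F : set 'M[R]_n :=
  [set A | forall f, F f -> mx_eval f A = 0].

Definition zariski_closed Z : Prop := exists F, Z = zero_locus F.

Definition zariski_closure S : set 'M[R]_n :=
  [set A | forall Z, zariski_closed Z -> S `<=` Z -> Z A].

(* Openness and density in the subspace topology that V inherits from
   the n * n affine space. *)
Definition zariski_open_in V U : Prop :=
  exists2 Z, zariski_closed Z & U = V `\` Z.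

Definition zariski_dense_in V U : Prop :=
  U `<=` V /\ V `<=` zariski_closure U.

End Zariski.

Definition is_partition (n m : nat) (lam : m.-tuple nat) : Prop :=
  [/\ sorted geq lam, all (leq 1) lam & sumn lam = n].

Section PartitionedEigenvalues.
Variables (R : realType) (n m : nat).

Definition symmetric_mx : set 'M[R]_n := [set A | A^T = A].

Definition skew_mx : set 'M[R]_n := [set B | B^T = - B].

Definition partitioned_eigenvalues (lam : m.-tuple nat) : set 'M[R]_n :=
  [set A | symmetric_mx A /\
    exists mu : 'I_m -> R,
      [/\ injective mu,
          forall a, eigenvalue A a <-> exists i, a = mu i
        & forall i, mup (mu i) (char_poly A) = tnth lam i]].

(* The closure is taken among all n x n matrices. As the symmetric matrices
   form a linear subspace, this is also the closure inside that subspace. *)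
Definition eigenvalue_variety (lam : m.-tuple nat) : set 'M[R]_n :=
  zariski_closure (partitioned_eigenvalues lam).

(* arr k is the index i of the parameter mu_i at the k-th diagonal position. *)
Definition is_arrangement (lam : m.-tuple nat) (arr : 'I_n -> 'I_m) : Prop :=
  forall i, #|[set k | arr k == i]%SET| = tnth lam i.

Definition diag_lam (arr : 'I_n -> 'I_m) (mu : 'rV[R]_m) : 'M[R]_n :=
  diag_mx (\row_k mu 0 (arr k)).

Definition cayley_param (arr : 'I_n -> 'I_m) (B : 'M[R]_n) (mu : 'rV[R]_m)
    : 'M[R]_n :=
  (1%:M - B) *m invmx (1%:M + B) *m diag_lam arr mu
    *m (1%:M + B) *m invmx (1%:M - B).

Definition cayley_image (arr : 'I_n -> 'I_m) : set 'M[R]_n :=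
  [set cayley_param arr B mu | B in skew_mx & mu in [set: 'rV[R]_m]].

(* Polynomials in the entries of B and the coordinates of mu: the first n * n
   variables stand for the entries of B, the last m for those of mu. *)
Definition param_eval (f : {mpoly R[n * n + m]}) (B : 'M[R]_n) (mu : 'rV[R]_m)
    : R :=
  f.@[fun k => row_mx (mxvec B) mu 0 k].

(* phi is a quotient of two polynomials whose denominator has no zero on
   Skew(n) x R^m. *)
Definition rational_on_skew (phi : 'M[R]_n -> 'rV[R]_m -> R) : Prop :=
  exists f g : {mpoly R[n * n + m]}, forall B mu, skew_mx B ->
    param_eval g B mu != 0 /\ phi B mu = param_eval f B mu / param_eval g B mu.

End PartitionedEigenvalues.

(* Main.v *)
Require Import Defs.
From mathcomp Require Import all_boot all_order all_fingroup all_algebra.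
From mathcomp Require Import mpoly.
From mathcomp Require Import boolp classical_sets reals.
From mathcomp Require Import complex ring.

(** The image of [p] is the whole variety, so it is trivially open and dense in
it. All three of the following sets coincide: the image of [p], the set [C] of
the matrices [Q *m diag_lam arr mu *m Q^T] with [Q] orthogonal and [mu]
arbitrary, and the Zariski closure of the symmetric matrices with eigenvalue
multiplicities [lam].

The image of [p] is [C] ([cayley_imageE]). For [B] skew, [1 + B] and [1 - B]
are invertible and [(1 - B) (1 + B)^-1] is orthogonal, so the image is in [C].
Conversely, an orthogonal [Q] is a Cayley transform as soon as -1 is not an
eigenvalue of [Q]. This can be achieved by changing the signs of some columns
of [Q] ([exists_sign_det_neq0]), and such a change does not affect
[Q *m diag_lam arr mu *m Q^T].

The set [C] is Zariski closed ([orthogonal_conjugates_closed]). By the real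
spectral theorem, a matrix is in [C] exactly when it is symmetric and its
eigenvalues can be ordered so that they are constant on the fibres of [arr].
Since the eigenvalues are real, this is the vanishing of a product, over all
orders, of sums of squares of differences of eigenvalues. That product is
symmetric in the eigenvalues, hence polynomial in the coefficients of the
characteristic polynomial. As [C] contains the matrices with multiplicities
[lam] ([partitioned_orthogonal_conjugate]), it contains their closure.

Finally [C] lies in that closure ([orthogonal_conjugate_closure]): any [mu] is
on a line whose points have distinct coordinates up to finitely many
exceptions, and a polynomial in one variable that vanishes at all but finitely
many points is zero. *)

Set Implicit Arguments.
Unset Strict Implicit.
Unset Printing Implicit Defensive.

Import Order.TTheory GRing.Theory Num.Theory.

Local Open Scope classical_set_scope.
Local Open Scope ring_scope.

(** * Orthogonal diagonalization of real symmetric matrices *)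

Lemma mulmx_tr_eq0 (R : realFieldType) n (v : 'rV[R]_n) :
  v *m v^T = 0 -> v = 0.
Proof.
move=> /matrixP /(_ 0 0); rewrite !mxE => /eqP.
rewrite psumr_eq0 => [/allP v0|k _]; last by rewrite mxE -expr2 sqr_ge0.
apply/rowP => k; rewrite mxE; apply/eqP.
by have := v0 k (mem_index_enum k); rewrite mxE mulf_eq0 orbb.
Qed.

(** The Householder reflection in the hyperplane orthogonal to [v - u]
exchanges the unit vectors [u] and [v]. It replaces the completion of [v] to
an orthonormal basis in the spectral theorem. *)
Lemma householder (R : realFieldType) n (u v : 'rV[R]_n) :
  u *m u^T = 1%:M -> v *m v^T = 1%:M ->
  exists2 Q : 'M[R]_n, Q *m Q^T = 1%:M & u *m Q = v.
Proof.
move=> uu vv; have [->|neq_vu] := eqVneq v u.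
  by exists 1%:M; rewrite ?trmx1 mulmx1.
have [w wE] : exists w, w = v - u by exists (v - u).
pose s := (w *m w^T) 0 0.
have ww : w *m w^T = s%:M by rewrite [LHS]mx11_scalar.
have s_neq0 : s != 0.
  apply: contra neq_vu => /eqP s0; rewrite -subr_eq0 -wE; apply/eqP.
  by apply: mulmx_tr_eq0; rewrite ww s0 raddf0.
have uwT : u *m w^T = (- (s / 2))%:M.
  pose t := (u *m v^T) 0 0.
  have uv : u *m v^T = t%:M by rewrite [LHS]mx11_scalar.
  have vu : v *m u^T = t%:M by rewrite -[LHS]trmxK trmx_mul trmxK uv tr_scalar_mx.
  have -> : s = 2 * (1 - t).
    rewrite /s wE linearB /= mulmxBl !mulmxBr uu vv uv vu !mxE eqxx !mulr1n; ring.
  rewrite wE linearB /= mulmxBr uv uu -raddfB /=; congr (_%:M); by field.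
exists (1%:M - (2 / s) *: (w^T *m w)).
  have -> : (1%:M - (2 / s) *: (w^T *m w))^T = 1%:M - (2 / s) *: (w^T *m w).
    by rewrite [LHS]raddfB /= trmx1 [X in _ - X]linearZ /= trmx_mul trmxK.
  rewrite mulmxBl mul1mx mulmxBr mulmx1 -!scalemxAl -!scalemxAr mulmxA.
  rewrite -[w^T *m w *m _]mulmxA ww mul_mx_scalar -scalemxAl !scalerA.
  rewrite -addrA -opprD -scalerBl -scalerDl.
  rewrite [X in X *: _](_ : _ = 0) ?scale0r ?subr0 //; by field.
rewrite mulmxBr mulmx1 -scalemxAr mulmxA uwT mul_scalar_mx scalerA.
have -> : 2 / s * - (s / 2) = -1 by field.
by rewrite scaleN1r opprK wE addrC subrK.
Qed.

(** Over [R[i]] the matrix is hermitian, hence unitarily diagonalizable with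
real eigenvalues; a real root of the characteristic polynomial over [R[i]] is
already a root over [R]. *)
Lemma symmetric_eigenvalue (R : rcfType) n (A : 'M[R]_n.+1) :
  A^T = A -> exists a, eigenvalue A a.
Proof.
move=> symA; pose C : numClosedFieldType := R[i].
pose f : {rmorphism R -> C} := real_complex R.
pose A' : 'M[C]_n.+1 := map_mx f A.
have realA : A' \is a mxOver Num.real.
  by apply/mxOverP => i j; rewrite mxE; apply/complex_realP; exists (A i j).
have hermA : A' \is hermitianmx _ false Num.Def.conjC.
  apply: realsym_hermsym => //; apply/is_hermitianmxP.
  by rewrite scale1r map_mx_id // /A' map_trmx symA.
have /hermitian_normalmx/orthomx_spectralP A'E := hermA.
set P := spectralmx A' in A'E.
have Punit : P \in unitmx by exact: spectral_unit.
have /mxOverP/(_ 0 0)/complex_realP[a dE] := hermitian_spectral_diag_real hermA.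
exists a; rewrite eigenvalue_root_char -(fmorph_root f) map_char_poly.
rewrite -eigenvalue_root_char; apply/eigenvalueP; exists (row 0 P).
  rewrite -row_mul [map_mx _ _]A'E !mulmxA mulmxV // mul1mx row_mul row_diag_mx.
  by rewrite -scalemxAl -rowE dE.
apply: contraTneq Punit => P0; apply/negP => Punit.
have /matrixP/(_ 0 0) : row 0 P *m invmx P = row 0 1%:M by rewrite -row_mul mulmxV.
by rewrite P0 mul0mx !mxE eqxx => /esym/eqP; rewrite oner_eq0.
Qed.

(** Induction on the size: an orthogonal [Q] that sends the first basis vector
to a unit eigenvector splits off a block of size one, and symmetry
clears the first column together with the first row. *)
Theorem symmetric_spectral (R : rcfType) n (A : 'M[R]_n) : A^T = A ->
  exists2 Q : 'M[R]_n, Q *m Q^T = 1%:M &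
    exists d : 'rV[R]_n, A = Q *m diag_mx d *m Q^T.
Proof.
elim: n => [|n IHn] in A *.
  move=> _; exists 1%:M; first by rewrite trmx1 mulmx1.
  by exists 0; apply/matrixP => -[].
rewrite -[n.+1]/(1 + n)%N in A *.
move=> symA; have [a /eigenvalueP[v0 v0A v0_neq0]] := @symmetric_eigenvalue _ n A symA.
pose s := (v0 *m v0^T) 0 0.
have s_gt0 : 0 < s.
  rewrite lt_neqAle eq_sym; apply/andP; split.
    apply: contra v0_neq0 => /eqP s0; apply/eqP/mulmx_tr_eq0.
    by rewrite [LHS]mx11_scalar -/s s0 raddf0.
  by rewrite /s mxE sumr_ge0 // => k _; rewrite mxE -expr2 sqr_ge0.
pose v := (Num.sqrt s)^-1 *: v0.
have vv : v *m v^T = 1%:M.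
  rewrite linearZ /= -scalemxAl -scalemxAr scalerA [v0 *m _]mx11_scalar -/s.
  rewrite scale_scalar_mx -invfM -expr2 sqr_sqrtr ?ltW // mulVf //.
  by rewrite gt_eqF.
have vA : v *m A = a *: v by rewrite -scalemxAl v0A !scalerA mulrC.
pose e : 'rV[R]_(1 + n) := row_mx 1%:M 0.
have ee : e *m e^T = 1%:M.
  by rewrite /e tr_row_mx mul_row_col mul0mx addr0 trmx1 mulmx1.
have [Q QQ eQ] := householder ee vv.
have QTQ : Q^T *m Q = 1%:M by exact: mulmx1C.
pose A1 : 'M[R]_(1 + n) := Q *m A *m Q^T.
have symA1 : A1^T = A1.
  by rewrite /A1 !trmx_mul trmxK symA mulmxA.
have eA1 : e *m A1 = a *: e.
  by rewrite /A1 !mulmxA eQ vA -scalemxAl -eQ -mulmxA QQ mulmx1.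
have : block_mx a%:M 0 0 (drsubmx A1) = A1.
  have uA1 : usubmx A1 = row_mx a%:M 0.
    have <- : e *m A1 = usubmx A1.
      by rewrite -{1}[A1]vsubmxK mul_row_col mul1mx mul0mx addr0.
    by rewrite eA1 scale_row_mx scaler0 scalemx1.
  rewrite -[RHS]submxK; congr block_mx.
  - by rewrite /ulsubmx uA1 row_mxKl.
  - by rewrite /ursubmx uA1 row_mxKr.
  - by rewrite -[RHS]trmxK trmx_dlsub symA1 /ursubmx uA1 row_mxKr trmx0.
have : (drsubmx A1)^T = drsubmx A1 by rewrite trmx_drsub symA1.
move=> /IHn[P PP [d A1E]] A1_block.
exists (Q^T *m block_mx 1%:M 0 0 P).
  rewrite trmx_mul trmxK tr_block_mx !trmx0 trmx1.
  rewrite mulmxA -[_ *m _ *m block_mx _ _ _ _]mulmxA mulmx_block.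
  rewrite !(mulmx0, mul0mx, addr0, add0r, mulmx1) PP.
  by rewrite -scalar_mx_block mulmx1.
exists (row_mx a%:M d); rewrite diag_mx_row trmx_mul trmxK !mulmxA.
have -> : diag_mx (a%:M : 'rV_1) = a%:M.
  by apply/matrixP => i j; rewrite !ord1 !mxE.
have -> : A = Q^T *m A1 *m Q.
  by rewrite /A1 !mulmxA QTQ mul1mx -mulmxA QTQ mulmx1.
congr (_ *m _); rewrite -!mulmxA; congr (_ *m _).
rewrite tr_block_mx !trmx0 trmx1 !mulmx_block.
by rewrite !(mulmx0, mul0mx, addr0, add0r, mulmx1, mul1mx) mulmxA -A1E A1_block.
Qed.

(** * Cayley transform *)

(** The determinant of [Q + diag_mx s] is affine in each coordinate of [s], with
[s_1 ... s_n] as its top monomial, so it cannot vanish at all vertices of the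
cube [{-1, 1}^n]. In the induction, the slope in the first coordinate is the
determinant of the same shape for the lower right block, and an affine
function with nonzero slope does not vanish at both 1 and -1. *)
Lemma exists_sign_det_neq0 (R : realFieldType) n (Q : 'M[R]_n) :
  exists2 s : 'rV[R]_n, forall k, s 0 k ^+ 2 = 1 & \det (Q + diag_mx s) != 0.
Proof.
elim: n => [|n IHn] in Q *.
  by exists 0 => [[]//|]; rewrite det_mx00 oner_eq0.
rewrite -[n.+1]/(1 + n)%N in Q *.
have [s s2 det_neq0] := IHn (@drsubmx _ 1 n 1 n Q).
pose S c : 'rV[R]_(1 + n) := row_mx c%:M s.
have S2 c : c ^+ 2 = 1 -> forall k, S c 0 k ^+ 2 = 1.
  move=> c2 k; rewrite mxE; case: splitP => j _; last exact: s2.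
  by rewrite !ord1 mxE eqxx mulr1n.
have detS c : \det (Q + diag_mx (S c)) =
    \det (Q + diag_mx (S 0)) + c * \det (@drsubmx _ 1 n 1 n Q + diag_mx s).
  (* The slope is the determinant with the first row replaced by (1, 0). *)
  pose E : 'M[R]_(1 + n) :=
    block_mx 1%:M 0 (dlsubmx Q) (@drsubmx _ 1 n 1 n Q + diag_mx s).
  rewrite -[X in _ + c * X]mul1r -[X in c * (X * _)](det1 R 1).
  rewrite -(det_lblock _ (dlsubmx Q)) -/E.
  rewrite -[X in _ = X + _]mul1r.
  have diagS x : Q + diag_mx (S x) = block_mx (ulsubmx Q + x%:M)
      (ursubmx Q) (dlsubmx Q) (@drsubmx _ 1 n 1 n Q + diag_mx s).
    rewrite diag_mx_row -[X in X + _]submxK add_block_mx !addr0.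
    congr block_mx; congr (_ + _).
    by apply/matrixP => i j; rewrite !ord1 !mxE.
  have row'_top (u u' : 'rV[R]_(1 + n)) (D : 'M[R]_(n, 1 + n)) :
      row' (lshift n (0 : 'I_1)) (col_mx u D) = row' (lshift n 0) (col_mx u' D).
    apply/matrixP => i j; rewrite ![row' _ _ _ _]mxE.
    rewrite (_ : lift _ i = rshift 1 i) ?col_mxEd //; exact: val_inj.
  apply: (@determinant_multilinear _ _ _ _ _ (lshift n (0 : 'I_1))).
  - rewrite !diagS /E !block_mxEv !rowKu scale1r -linearZ -linearD /=.
    by rewrite scale_row_mx add_row_mx scaler0 scalemx1 !addr0 raddf0 addr0.
  - by rewrite !diagS !block_mxEv; apply: row'_top.
  - by rewrite !diagS /E !block_mxEv; apply: row'_top.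
have [det1_0|] := eqVneq (\det (Q + diag_mx (S 1))) 0; last first.
  by exists (S 1) => //; apply: S2; rewrite expr1n.
exists (S (-1)); first by apply: S2; rewrite sqrrN expr1n.
have /esym/eqP := detS 1; rewrite det1_0 mul1r addr_eq0 => /eqP D0.
rewrite detS D0 mulN1r -opprD oppr_eq0 -mulr2n.
by rewrite mulrn_eq0.
Qed.

Section Cayley.
Variables (R : realType) (n : nat).
Implicit Types B Q : 'M[R]_n.

Definition cayley_mx B : 'M[R]_n := (1%:M - B) *m invmx (1%:M + B).

Lemma skewN B : skew_mx B -> skew_mx (- B).
Proof. by rewrite /skew_mx /= linearN /= => ->. Qed.

(** If [v *m B = - v] with [B] skew, then [v *m v^T] equals its own opposite,
so [v = 0]. *)
Lemma skew_add_unit B : skew_mx B -> 1%:M + B \in unitmx.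
Proof.
rewrite /skew_mx /= => skewB; rewrite -row_free_unit -kermx_eq0.
apply/eqP/row_matrixP => i; rewrite row0; set v := row i _.
have vB : v *m B = - v.
  apply/eqP; rewrite -addr_eq0 addrC -[X in X + _]mulmx1 -mulmxDr.
  by rewrite /v -row_mul mulmx_ker row0.
have BvT : B *m v^T = v^T.
  by rewrite -[LHS]trmxK trmx_mul trmxK skewB mulmxN vB opprK.
have : v *m v^T = - (v *m v^T) by rewrite -{1}BvT mulmxA vB mulNmx.
move=> /eqP; rewrite -addr_eq0 -mulr2n => /eqP/matrixP vv0.
apply: mulmx_tr_eq0; apply/matrixP => a b; apply/eqP.
by have /eqP := vv0 a b; rewrite mulmxnE [(0 : 'M_(_, _)) _ _]mxE mulrn_eq0.
Qed.

Lemma skew_sub_unit B : skew_mx B -> 1%:M - B \in unitmx.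
Proof. by move=> /skewN/skew_add_unit. Qed.

Lemma cayley_mx_trE B : skew_mx B ->
  (cayley_mx B)^T = (1%:M + B) *m invmx (1%:M - B).
Proof.
move=> skewB; have [uD uB] := (skew_add_unit skewB, skew_sub_unit skewB).
rewrite /cayley_mx trmx_mul trmx_inv.
rewrite [(1%:M - B)^T]linearB [(1%:M + B)^T]linearD /= trmx1 skewB opprK.
apply: (can_inj (mulKmx uB)); apply: (can_inj (mulmxK uB)).
rewrite (mulKVmx uB) -[RHS]mulmxA (mulmxKV uB).
by rewrite mulmxBr mulmxBl !mulmxDr !mulmxDl !mulmx1 !mul1mx.
Qed.

Lemma cayley_mx_orthogonal B : skew_mx B -> cayley_mx B *m (cayley_mx B)^T = 1%:M.
Proof.
move=> skewB; have [uD uB] := (skew_add_unit skewB, skew_sub_unit skewB).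
rewrite cayley_mx_trE // /cayley_mx mulmxA mulmxKV //.
by rewrite mulmxV.
Qed.

(** The Cayley transform is an involution, so the preimage of [Q] is the Cayley
transform of [Q] itself; orthogonality of [Q] makes it skew. *)
Lemma cayley_mx_surj Q : Q *m Q^T = 1%:M -> 1%:M + Q \in unitmx ->
  exists2 B, skew_mx B & cayley_mx B = Q.
Proof.
move=> QQ uQ; have QTQ : Q^T *m Q = 1%:M by exact: mulmx1C.
have two : (2%:R : R) \is a GRing.unit by rewrite unitfE pnatr_eq0.
exists (cayley_mx Q).
  have uQT : 1%:M + Q^T \in unitmx.
    by rewrite -unitmx_tr linearD /= trmx1 trmxK.
  rewrite /skew_mx /cayley_mx /= trmx_mul trmx_inv.
  rewrite [(1%:M - Q)^T]linearB [(1%:M + Q)^T]linearD /= trmx1.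
  apply: (can_inj (mulKmx uQT)); apply: (can_inj (mulmxK uQ)).
  rewrite mulmxA mulmxV // mul1mx mulmxN mulNmx -!mulmxA mulVmx // mulmx1.
  rewrite !(mulmxDl, mulmxDr, mulmxN, mulNmx, mul1mx, mulmx1) QTQ.
  by apply/matrixP => i j; rewrite !mxE; ring.
change ((1%:M - cayley_mx Q) *m invmx (1%:M + cayley_mx Q) = Q).
have <- : (2 *: invmx (1%:M + Q)) = 1%:M + cayley_mx Q.
  apply: (can_inj (mulmxK uQ)).
  rewrite mulmxDl mulmxKV // -scalemxAl mulVmx // mul1mx addrA.
  by rewrite addrAC addrK scaler_nat.
have -> : 1%:M - cayley_mx Q = 2 *: (Q *m invmx (1%:M + Q)).
  apply: (can_inj (mulmxK uQ)).
  rewrite mulmxBl -scalemxAl !mulmxKV // mul1mx opprB addrC addrA subrK.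
  by rewrite scaler_nat.
rewrite invmxZ ?unitmxZ ?unitmx_inv // invmxK -scalemxAl -scalemxAr.
by rewrite mulmxKV // scalerA mulrV // scale1r.
Qed.
End Cayley.

(** The common value of the image of [p] and of the variety: every symmetric
matrix whose eigenvalues can be grouped according to [arr], where values of
distinct groups are allowed to coincide. *)
Definition orthogonal_conjugates (R : realType) n m (arr : 'I_n -> 'I_m)
    : set 'M[R]_n :=
  [set A | exists2 Q : 'M[R]_n, Q *m Q^T = 1%:M &
    exists mu : 'rV[R]_m, A = Q *m diag_lam arr mu *m Q^T].

(** Replacing [Q] by [Q *m diag_mx s], with [s] a vector of signs, leaves the
conjugate of a diagonal matrix unchanged, and for a suitable choice of signs
-1 is not an eigenvalue of the new [Q], which is then a Cayley transform. *)
Lemma cayley_imageE (R : realType) n m (arr : 'I_n -> 'I_m) :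
  @cayley_image R n m arr = orthogonal_conjugates arr.
Proof.
have paramE B mu : skew_mx B -> @cayley_param R n m arr B mu =
    cayley_mx B *m diag_lam arr mu *m (cayley_mx B)^T.
  by move=> skewB; rewrite cayley_mx_trE // mulmxA.
apply/seteqP; split=> [A [B skewB [mu _ <-]]|A [Q QQ [mu ->]]].
  exists (cayley_mx B); first exact: cayley_mx_orthogonal.
  by exists mu; rewrite paramE.
have [s s2 det_neq0] := exists_sign_det_neq0 Q.
have SS : diag_mx s *m diag_mx s = 1%:M.
  rewrite mulmx_diag; apply/matrixP => i j.
  by rewrite !mxE -expr2 s2.
have [|//|B skewB QE] := @cayley_mx_surj R n (Q *m diag_mx s).
- by rewrite trmx_mul tr_diag_mx mulmxA -[X in X *m _]mulmxA SS mulmx1.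
- rewrite -SS -mulmxDl unitmx_mul addrC unitmxE unitfE det_neq0 /=.
  by case/mulmx1_unit: SS.
exists B => //; exists mu => //; rewrite paramE // QE trmx_mul tr_diag_mx.
rewrite mulmxA -[Q *m _ *m _]mulmxA [diag_mx s *m _]diag_mxC.
by rewrite -!mulmxA (mulmxA (diag_mx s)) SS mul1mx.
Qed.

(** * Spectrum of an orthogonally diagonalized matrix *)

Lemma char_poly_orthogonal_conj (R : realType) n (Q : 'M[R]_n) (d : 'rV[R]_n) :
  Q *m Q^T = 1%:M ->
  char_poly (Q *m diag_mx d *m Q^T) = \prod_k ('X - (d 0 k)%:P).
Proof.
move=> QQ; pose P := map_mx polyC Q.
have PP : P *m map_mx polyC Q^T = 1%:M by rewrite -map_mxM QQ map_mx1.
transitivity (char_poly (diag_mx d)); last first.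
  rewrite char_poly_trig; first by apply: eq_bigr => k _; rewrite mxE eqxx.
  by apply/is_trig_mxP => i j /ltn_eqF ij; rewrite mxE -val_eqE ij.
have -> : char_poly (Q *m diag_mx d *m Q^T) =
    \det (P *m char_poly_mx (diag_mx d) *m map_mx polyC Q^T).
  congr (\det _); rewrite /char_poly_mx mulmxBr mulmxBl !map_mxM.
  rewrite mul_mx_scalar -scalemxAl -scalemx1; congr (_ *: _ - _).
  exact: esym PP.
rewrite !det_mulmx mulrAC [X in X * _](_ : _ = 1) ?mul1r // -det_mulmx.
by rewrite -(det1 _ n); congr (\det _); exact: PP.
Qed.

Lemma root_prod_XsubC_ord (F : fieldType) n (d : 'I_n -> F) x :
  root (\prod_k ('X - (d k)%:P)) x <-> exists k, x = d k.
Proof.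
rewrite -(big_map d xpredT (fun a => 'X - a%:P)) root_prod_XsubC.
split=> [/mapP[k _ ->]|[k ->]]; first by exists k.
by apply: map_f; exact: mem_index_enum.
Qed.

Lemma mup_prod_XsubC (F : fieldType) n (d : 'I_n -> F) x :
  mup x (\prod_k ('X - (d k)%:P)) = #|[set k | d k == x]%SET|.
Proof.
rewrite -sum1dep_card [RHS]big_mkcond /=.
suff [_ ->] : \prod_k ('X - (d k)%:P) != 0 /\
    mup x (\prod_k ('X - (d k)%:P)) = (\sum_k (if d k == x then 1 else 0))%N by [].
elim/big_rec2: _ => [|k m p _ [p_neq0 mupE]].
  by rewrite oner_neq0 mupNroot // root1.
have Xd_neq0 : 'X - (d k)%:P != 0 by rewrite polyXsubC_eq0.
by rewrite mulf_neq0 // mupM // mupE -['X - _]expr1 mup_XsubCX.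
Qed.

Lemma exists_matching_perm (T : eqType) n (f g : 'I_n -> T) :
  (forall x, #|[set k | f k == x]%SET| = #|[set k | g k == x]%SET|) ->
  exists s : 'S_n, forall k, f k = g (s k).
Proof.
move=> fg; have countE (h : 'I_n -> T) x :
    count_mem x [tuple h k | k < n] = #|[set k | h k == x]%SET|.
  by rewrite -sum1_count big_map big_enum_cond sum1dep_card.
have /tuple_permP[s fE] : perm_eq [tuple f k | k < n] [tuple g k | k < n].
  by apply/allP => x _; rewrite /= !countE fg.
exists s => k; have := congr1 (fun t : n.-tuple T => tnth t k) (val_inj fE).
by rewrite !tnth_mktuple.
Qed.

(** * Zariski closedness of the set of orthogonal conjugates *)

Section Coordinates.
Variables (R : realType) (n : nat).
Local Notation entry := (fun A : 'M[R]_n => fun k => mxvec A 0 k).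

Definition generic_mx : 'M[{mpoly R[n * n]}]_n :=
  \matrix_(i, j) 'X_(mxvec_index i j).

Lemma map_generic_mx (A : 'M[R]_n) : map_mx (meval (entry A)) generic_mx = A.
Proof. by apply/matrixP => i j; rewrite !mxE mevalXU mxvecE. Qed.

Lemma mx_eval_char_poly k (A : 'M[R]_n) :
  mx_eval (char_poly generic_mx)`_k A = (char_poly A)`_k.
Proof.
by rewrite /mx_eval -(coef_map (meval (entry A))) map_char_poly map_generic_mx.
Qed.

(** A symmetric polynomial in the eigenvalues is a polynomial in the
elementary symmetric ones, which by Vieta are, up to sign, the coefficients of
the characteristic polynomial, hence polynomials in the entries. *)
Lemma mx_eval_root_symmetric (p : {mpoly R[n]}) : p \is symmetric ->
  exists f : {mpoly R[n * n]}, forall (A : 'M[R]_n) (d : 'I_n -> R),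
    char_poly A = \prod_k ('X - (d k)%:P) -> mx_eval f A = p.@[d].
Proof.
move=> /sym_fundamental[t [<- _]].
pose c (i : 'I_n) : {mpoly R[n * n]} :=
  (-1) ^+ i.+1 *: (char_poly generic_mx)`_(n - i.+1).
exists (t \mPo [tuple c i | i < n]) => A d charA.
rewrite /mx_eval !comp_mpoly_meval; apply: meval_eq => i.
rewrite !tnth_mktuple mevalZ -/(mx_eval _ _) mx_eval_char_poly charA.
have := mroots_coeff [tuple d k | k < n] (Ordinal (ltn_ord i : (i.+1 < n.+1)%N)).
rewrite big_map big_enum /= => ->.
rewrite mulrA -expr2 sqrr_sign mul1r; apply: meval_eq => k.
by rewrite tnth_mktuple.
Qed.

(** Over the reals a sum of squares encodes a conjunction of equations and a
product encodes a disjunction. So this polynomial vanishes at a point exactly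
when the coordinates, in some order, are constant on the fibres of [arr]. The
product over all orders makes it symmetric. *)
Definition matching_mpoly m (arr : 'I_n -> 'I_m) : {mpoly R[n]} :=
  \prod_(s : 'S_n) \sum_k \sum_(l | arr l == arr k) ('X_(s k) - 'X_(s l)) ^+ 2.

Lemma matching_mpoly_sym m (arr : 'I_n -> 'I_m) : matching_mpoly arr \is symmetric.
Proof.
apply/issymP => t; rewrite /matching_mpoly rmorph_prod /=.
rewrite [RHS](reindex_inj (mulIg t)); apply: eq_bigr => s _ /=.
rewrite rmorph_sum; apply: eq_bigr => k _ /=.
rewrite rmorph_sum; apply: eq_bigr => l _ /=.
have msymXU i : msym t 'X_i = 'X_(t i) :> {mpoly R[n]}.
  by rewrite [LHS]mmapX mmap1U.
by rewrite rmorphXn rmorphB /= !msymXU !permM.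
Qed.

Lemma matching_mpoly_eq0 m (arr : 'I_n -> 'I_m) (d : 'I_n -> R) :
  (matching_mpoly arr).@[d] = 0 <->
  exists s : 'S_n, forall k l, arr k = arr l -> d (s k) = d (s l).
Proof.
have -> : (matching_mpoly arr).@[d] =
    \prod_(s : 'S_n) \sum_k \sum_(l | arr l == arr k) (d (s k) - d (s l)) ^+ 2.
  rewrite /matching_mpoly rmorph_prod; apply: eq_bigr => s _ /=.
  rewrite rmorph_sum; apply: eq_bigr => k _ /=.
  rewrite rmorph_sum; apply: eq_bigr => l _ /=.
  by rewrite rmorphXn rmorphB /= !mevalXU.
have sum_ge0 s k : 0 <= \sum_(l | arr l == arr k) (d (s k) - d (s l)) ^+ 2.
  by apply: sumr_ge0 => l _; exact: sqr_ge0.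
split=> [/eqP/prodf_eq0[s _ /eqP sum0]|[s ds]].
  exists s => k l arr_kl.
  have sum_k0 := @psumr_eq0P _ _ _ _ (fun i _ => sum_ge0 s i) sum0 k isT.
  have arr_lk : arr l == arr k by rewrite arr_kl.
  have /eqP :=
    @psumr_eq0P _ _ _ _ (fun i _ => sqr_ge0 (d (s k) - d (s i))) sum_k0 l arr_lk.
  by rewrite sqrf_eq0 subr_eq0 => /eqP.
apply/eqP/prodf_eq0; exists s => //; apply/eqP.
apply: big1 => k _; apply: big1 => l /eqP arr_kl.
by rewrite (ds k l) // subrr expr0n.
Qed.

End Coordinates.

(** Conjugation by a permutation matrix reorders the diagonal. *)
Lemma matched_orthogonal_conjugate (R : realType) n m (arr : 'I_n -> 'I_m)
    (Q : 'M[R]_n) (d : 'rV[R]_n) (s : 'S_n) (mu : 'I_m -> R) :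
  Q *m Q^T = 1%:M -> (forall k, mu (arr k) = d 0 (s k)) ->
  orthogonal_conjugates arr (Q *m diag_mx d *m Q^T).
Proof.
move=> QQ mud; pose P : 'M[R]_n := perm_mx s.
have PTP : P^T *m P = 1%:M by rewrite tr_perm_mx -perm_mxM mulVg perm_mx1.
exists (Q *m P^T).
  by rewrite trmx_mul trmxK mulmxA -(mulmxA Q) PTP mulmx1.
exists (\row_i mu i).
have -> : diag_lam arr (\row_i mu i) = P *m diag_mx d *m P^T.
  rewrite -row_permE tr_perm_mx -col_permE; apply/matrixP => i j.
  by rewrite !mxE mud (inj_eq perm_inj).
rewrite trmx_mul trmxK !mulmxA -[Q *m P^T *m P]mulmxA PTP mulmx1.
by rewrite -[_ *m P^T *m P]mulmxA PTP mulmx1.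
Qed.

(** The equations are the symmetry of the matrix, and [matching_mpoly]
evaluated at the eigenvalues and rewritten in the entries. By the spectral
theorem a symmetric real matrix has all its eigenvalues in [R], so no solution
comes from complex eigenvalues. *)
Lemma orthogonal_conjugates_closed (R : realType) n m (arr : 'I_n -> 'I_m) :
  zariski_closed (@orthogonal_conjugates R n m arr).
Proof.
have [f fE] := mx_eval_root_symmetric (@matching_mpoly_sym R n m arr).
exists [set g | g = f \/
  exists i j, g = 'X_(mxvec_index i j) - 'X_(mxvec_index j i)].
apply/seteqP; split=> [A [Q QQ [mu ->]]|A A0].
  move=> g [->|[i [j ->]]].
    rewrite (fE _ _ (char_poly_orthogonal_conj _ QQ)).
    apply/matching_mpoly_eq0; exists 1%g => k l arr_kl.
    by rewrite !perm1 !mxE arr_kl.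
  rewrite /mx_eval rmorphB /= !mevalXU !mxvecE; apply/eqP; rewrite subr_eq0.
  apply/eqP; set B := _ *m _ *m _; suff {1}<- : B^T = B by rewrite mxE.
  by rewrite /B !trmx_mul trmxK /diag_lam tr_diag_mx mulmxA.
have symA : A^T = A.
  apply/matrixP => i j; rewrite mxE; apply/eqP; rewrite -subr_eq0; apply/eqP.
  have := A0 _ (or_intror (ex_intro _ j (ex_intro _ i erefl))).
  by rewrite /mx_eval rmorphB /= !mevalXU !mxvecE.
have [Q QQ [d AE]] := symmetric_spectral symA.
have := A0 _ (or_introl erefl); rewrite (fE _ (d 0)); last first.
  by rewrite AE char_poly_orthogonal_conj.
move=> /matching_mpoly_eq0[s ds]; rewrite AE.
(* The default 0 concerns only indices outside the image of [arr]. *)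
pose mu i := if [pick k | arr k == i] is Some k then d 0 (s k) else 0.
apply: (@matched_orthogonal_conjugate _ _ _ _ _ _ s mu) => // k.
rewrite /mu; case: pickP => [l /eqP/ds //|/(_ k)]; by rewrite eqxx.
Qed.

(** The eigenvalues of [A] and the values [mu (arr k)] form the same multiset,
because the multiplicity of [mu i] is the size of the fibre of [arr] at [i]. *)
Lemma partitioned_orthogonal_conjugate (R : realType) n m (lam : m.-tuple nat)
    (arr : 'I_n -> 'I_m) : is_arrangement lam arr ->
  @partitioned_eigenvalues R n m lam `<=` orthogonal_conjugates arr.
Proof.
move=> arr_lam A [symA [mu [mu_inj eigA mupA]]].
have [Q QQ [d AE]] := symmetric_spectral symA.
have charA : char_poly A = \prod_k ('X - (d 0 k)%:P).
  by rewrite AE char_poly_orthogonal_conj.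
have card_mu i : #|[set k | mu (arr k) == mu i]%SET| = tnth lam i.
  by rewrite -arr_lam; apply: eq_card => k; rewrite !inE (inj_eq mu_inj).
have [x|s muE] := @exists_matching_perm _ _ (mu \o arr) (d 0).
  have [[i ->]|no_i] := pselect (exists i, x = mu i).
    by rewrite card_mu -mupA charA mup_prod_XsubC.
  rewrite !eq_card0 // => k; rewrite !inE; apply/negP => /eqP kx; apply: no_i.
    apply/eigA; rewrite eigenvalue_root_char charA.
    by apply/root_prod_XsubC_ord; exists k.
  by exists (arr k).
by rewrite AE; apply: (@matched_orthogonal_conjugate _ _ _ _ _ _ s mu).
Qed.

(** * Density of the matrices with distinct parameters *)

Lemma poly_horner_eq0 (R : numDomainType) (p : {poly R}) :
  (forall x, p.[x] = 0) -> p = 0.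
Proof.
move=> p0; apply/eqP/negPn/negP => p_neq0.
have uniq_r : uniq [seq (i%:R : R) | i <- iota 0 (size p)].
  by rewrite map_inj_uniq ?iota_uniq //; exact: (mulrIn (oner_neq0 R)).
have : all (root p) [seq (i%:R : R) | i <- iota 0 (size p)].
  by apply/allP => x _; rewrite rootE p0.
by move=> /(max_poly_roots p_neq0)/(_ uniq_r); rewrite size_map size_iota ltnn.
Qed.

Lemma distinct_mem_partitioned (R : realType) n m (lam : m.-tuple nat)
    (arr : 'I_n -> 'I_m) (Q : 'M[R]_n) (mu : 'rV[R]_m) :
  is_partition n lam -> is_arrangement lam arr -> Q *m Q^T = 1%:M ->
  injective (mu 0) ->
  partitioned_eigenvalues lam (Q *m diag_lam arr mu *m Q^T).
Proof.
move=> [_ /allP lam_gt0 _] arr_lam QQ mu_inj.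
have charE : char_poly (Q *m diag_lam arr mu *m Q^T) =
    \prod_k ('X - (mu 0 (arr k))%:P).
  by rewrite char_poly_orthogonal_conj //; apply: eq_bigr => k _; rewrite mxE.
split; first by rewrite /symmetric_mx /= !trmx_mul trmxK tr_diag_mx mulmxA.
exists (mu 0); split=> // [a|i].
  rewrite eigenvalue_root_char charE root_prod_XsubC_ord.
  split=> [[k ->]|[i ->]]; first by exists (arr k).
  have : (0 < #|[set k | arr k == i]%SET|)%N.
    by rewrite arr_lam; apply: lam_gt0; exact: mem_tnth.
  by case/card_gt0P => k; rewrite inE => /eqP <-; exists k.
rewrite charE mup_prod_XsubC -arr_lam.
by apply: eq_card => k; rewrite !inE (inj_eq mu_inj).
Qed.

(** This turns membership of a curve in a Zariski closed set into the vanishing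
of polynomials in one variable. *)
Lemma mx_eval_poly_curve (R : realType) n (f : {mpoly R[n * n]})
    (N : 'M[{poly R}]_n) :
  exists h : {poly R}, forall x, h.[x] = mx_eval f (map_mx (horner_eval x) N).
Proof.
exists (mmap polyC (fun k => mxvec N 0 k) f) => x.
rewrite /mx_eval mevalE /mmap -horner_evalE rmorph_sum; apply: eq_bigr => u _ /=.
rewrite rmorphM rmorph_prod /= horner_evalE hornerC; congr (_ * _).
by apply: eq_bigr => k _; rewrite rmorphXn /= -map_mxvec [in RHS]mxE.
Qed.

(** Move the parameters along the line [mu i + x * i]. They are pairwise
distinct for all but finitely many [x], so an equation of the partitioned
matrices holds along the line up to finitely many [x], hence also at [x = 0]. *)
Lemma orthogonal_conjugate_closure (R : realType) n m (lam : m.-tuple nat)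
    (arr : 'I_n -> 'I_m) : is_partition n lam -> is_arrangement lam arr ->
  orthogonal_conjugates arr `<=` @eigenvalue_variety R n m lam.
Proof.
move=> lam_part arr_lam _ [Q QQ [mu ->]] _ [F ->] vanish f Ff.
pose mu_ x : 'rV[R]_m := \row_i (mu 0 i + x * (i : nat)%:R).
pose N : 'M[{poly R}]_n := map_mx polyC Q *m
  diag_mx (\row_k ((mu 0 (arr k))%:P + 'X * (arr k : nat)%:R%:P)) *m
  map_mx polyC Q^T.
have NE x : map_mx (horner_eval x) N = Q *m diag_lam arr (mu_ x) *m Q^T.
  have evalC k l (M : 'M[R]_(k, l)) : map_mx (horner_eval x) (map_mx polyC M) = M.
    by apply/matrixP => i j; rewrite !mxE horner_evalE hornerC.
  rewrite !map_mxM !evalC map_diag_mx; congr (_ *m diag_mx _ *m _).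
  by apply/rowP => k; rewrite !mxE /= horner_evalE !hornerE.
have [h hE] := mx_eval_poly_curve f N.
(* The roots of [w] are the parameters of the line at which two values collide. *)
pose w : {poly R} := \prod_(i : 'I_m) \prod_(j : 'I_m | i != j)
  ((mu 0 i - mu 0 j)%:P + 'X * ((i : nat)%:R - (j : nat)%:R)%:P).
have w_neq0 : w != 0.
  apply/prodf_neq0 => i _; apply/prodf_neq0 => j neq_ij.
  apply: contraNneq neq_ij => /(congr1 (fun p : {poly R} => p`_1)).
  rewrite coefD coefXM coefC coefC coef0 /= add0r => /eqP.
  by rewrite subr_eq0 eqr_nat.
have hw0 : h * w = 0.
  apply: poly_horner_eq0 => x; rewrite hornerM.
  have [->|wx_neq0] := eqVneq w.[x] 0; first by rewrite mulr0.
  rewrite hE NE vanish ?mul0r //.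
  apply: distinct_mem_partitioned => // i j; rewrite !mxE => mu_ij.
  apply/eqP; apply: contraNT wx_neq0 => neq_ij.
  rewrite /w horner_prod; apply/prodf_eq0; exists i => //; apply/eqP.
  rewrite horner_prod; apply/eqP/prodf_eq0; exists j => //; apply/eqP.
  by rewrite !hornerE mulrBr addrACA -opprD mu_ij subrr.
move/eqP: hw0; rewrite mulf_eq0 (negPf w_neq0) orbF => /eqP h0.
have := hE 0; rewrite h0 horner0 NE => /esym.
suff -> : mu_ 0 = mu by [].
by apply/rowP => i; rewrite mxE mul0r addr0.
Qed.

(** * The parametrization *)

Lemma cayley_image_eq_variety (R : realType) n m (lam : m.-tuple nat)
    (arr : 'I_n -> 'I_m) : is_partition n lam -> is_arrangement lam arr ->
  @cayley_image R n m arr = eigenvalue_variety lam.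
Proof.
move=> lam_part arr_lam; rewrite cayley_imageE; apply/seteqP; split.
  exact: orthogonal_conjugate_closure.
move=> A; apply; first exact: orthogonal_conjugates_closed.
exact: partitioned_orthogonal_conjugate.
Qed.

(** By Cramer's rule both inverses have polynomial entries up to the
denominator [\det (1 + B) * \det (1 - B)]. *)
Lemma cayley_param_rational (R : realType) n m (arr : 'I_n -> 'I_m) i j :
  rational_on_skew (fun (B : 'M[R]_n) mu => cayley_param arr B mu i j).
Proof.
pose GB : 'M[{mpoly R[n * n + m]}]_n :=
  \matrix_(i, j) 'X_(lshift m (mxvec_index i j)).
pose D : 'M[{mpoly R[n * n + m]}]_n :=
  diag_mx (\row_k 'X_(rshift (n * n) (arr k))).
pose ev (B : 'M[R]_n) (mu : 'rV[R]_m) : {rmorphism {mpoly R[n * n + m]} -> R} :=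
  meval (fun k => row_mx (mxvec B) mu 0 k).
have evB B mu : map_mx (ev B mu) GB = B.
  by apply/matrixP => k l; rewrite !mxE /= /ev mevalXU row_mxEl mxvecE.
have evD B mu : map_mx (ev B mu) D = diag_lam arr mu.
  rewrite map_diag_mx; congr diag_mx; apply/rowP => k.
  by rewrite !mxE /= /ev mevalXU row_mxEr.
exists (((1%:M - GB) *m \adj (1%:M + GB) *m D *m (1%:M + GB)
    *m \adj (1%:M - GB)) i j).
exists (\det (1%:M + GB) * \det (1%:M - GB)) => B mu skewB.
have [uD uB] := (skew_add_unit skewB, skew_sub_unit skewB).
have denE : param_eval (\det (1%:M + GB) * \det (1%:M - GB)) B mu =
    \det (1%:M + B) * \det (1%:M - B).
  rewrite [LHS](rmorphM (ev B mu)) /= -!det_map_mx.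
  by rewrite map_mxD map_mxB map_mx1 evB.
split; first by rewrite denE -unitfE unitrM -!unitmxE uD.
set M := (_ *m \adj (1%:M - GB)).
have -> : param_eval (M i j) B mu = map_mx (ev B mu) M i j by rewrite [RHS]mxE.
rewrite !map_mxM !map_mx_adj map_mxB !map_mxD map_mx1 evB evD.
rewrite denE /cayley_param /invmx uD uB -!(scalemxAr, scalemxAl) scalerA.
by rewrite [LHS]mxE mulrC invfM [X in _ * X = _]mulrC.
Qed.

(* The first conjunct says that p is well defined: [invmx] is total and returns
   its argument on a singular matrix. *)
Theorem proposition2p1 (R : realType) (n m : nat) (lam : m.-tuple nat)
    (arr : 'I_n -> 'I_m)
    (lam_part : is_partition n lam)
    (lam_neq1 : tval lam <> nseq m 1%N)
    (arr_lam : is_arrangement lam arr) :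
  [/\ forall B : 'M[R]_n, skew_mx B ->
        1%:M + B \in unitmx /\ 1%:M - B \in unitmx,
      forall i j : 'I_n,
        rational_on_skew (fun B (mu : 'rV[R]_m) => cayley_param arr B mu i j),
      zariski_open_in (@eigenvalue_variety R n m lam) (cayley_image arr)
    & zariski_dense_in (@eigenvalue_variety R n m lam) (cayley_image arr)].
Proof.
have image_eq := @cayley_image_eq_variety R n m lam arr lam_part arr_lam.
split.
- by move=> B skewB; rewrite skew_add_unit ?skew_sub_unit.
- exact: cayley_param_rational.
- rewrite image_eq; exists set0; last by rewrite setD0.
  (* The empty set is the zero locus of the constant 1. *)
  exists [set 1]; apply/seteqP; split=> // A /(_ 1 erefl) /eqP.
  by rewrite /mx_eval rmorph1 oner_eq0.
- by rewrite image_eq; split=> // A VA Z _; apply.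
Qed.
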